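(* Let $\mathbb{A}$ be one of the real normed division algebras $\mathbb{C}, \mathbb{H}, \mathbb{O}$, of dimension $d_{\rm A} \ge 2$ over $\mathbb{R}$. Let $P(x) \in \mathbb{R}[x]$ and let $x_0 \in \mathbb{A} \setminus \mathbb{R}$ be a root of $P$. Then the dimension $d_{\rm M}$ of the root manifold $M_{x_0}$ is $d_{\rm M} = d_{\rm A} - 2$.
   Context: $\operatorname{Aut}(\mathbb{A})$ is the group of bijective $\mathbb{R}$-linear maps $g : \mathbb{A} \to \mathbb{A}$ with $g(xy) = g(x)g(y)$. The root manifold $M_{x_0}$ is the orbit $\{g(x_0) : g \in \operatorname{Aut}(\mathbb{A})\}$, which is contained in the zero set of $P$ in $\mathbb{A}$. Polynomials are evaluated as $P(x) = \sum_k a_k x^k$. *)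

(* Defs.v *)
From HB Require Import structures.
From mathcomp Require Import all_boot all_order all_algebra.
From mathcomp Require Import complex.
From mathcomp Require Import all_classical all_reals all_analysis.
Import Order.TTheory GRing.Theory Num.Theory numFieldNormedType.Exports.

Set Implicit Arguments.
Unset Strict Implicit.
Unset Printing Implicit Defensive.

Local Open Scope classical_set_scope.
Local Open Scope ring_scope.

Section RcomplexVector.
Variable R : rcfType.

Definition Rcomplex_coords (z : Rcomplex R) : 'rV[R]_2 :=
  \row_i (if i == 0 then complex.Re z else complex.Im z).

Fact Rcomplex_vect_iso : Vector.axiom 2 (Rcomplex R).
Proof.
exists Rcomplex_coords; first by move=> a [x y] [z t]; apply/rowP=> i; rewrite !mxE; case: ifP.
exists (fun v : 'rV[R]_2 => Complex (v 0 0) (v 0 1) : Rcomplex R).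
  by move=> [x y]; rewrite /= !mxE.
move=> v; apply/rowP=> i; rewrite mxE /=.
by case: (unliftP 0 i) => [j ->|->] //=; rewrite (ord1 j); congr (v 0 _); apply/val_inj.
Qed.

HB.instance Definition _ :=
  Lmodule_hasFinDim.Build R (Rcomplex R) Rcomplex_vect_iso.

End RcomplexVector.

(* MathComp rings are associative, so a possibly nonassociative algebra is given
   by raw operations on a finite-dimensional real vector space.  The operation
   amul on a product A * B is not MathComp's componentwise product of pairs. *)
Record star_algebra (R : nzRingType) := StarAlgebra {
  acarrier :> vectType R;
  aone : acarrier;
  amul : acarrier -> acarrier -> acarrier;
  aconj : acarrier -> acarrier }.

Arguments StarAlgebra {R}.
Arguments aone {R}.
Arguments amul {R s}.
Arguments aconj {R s}.

(* Cayley-Dickson: (a, b) (c, d) = (a c - d^* b, d a + b c^* ) and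
   (a, b)^* = (a^*, - b). *)
Definition cayley_dickson (R : nzRingType) (A : star_algebra R) :
    star_algebra R :=
  StarAlgebra (A * A)%type
    (aone A, 0)
    (fun x y => (amul x.1 y.1 - amul (aconj y.2) x.2,
                 amul y.2 x.1 + amul x.2 (aconj y.1)))
    (fun x => (aconj x.1, - x.2)).

Definition complex_algebra (R : rcfType) : star_algebra R :=
  StarAlgebra (Rcomplex R) 1 (fun x y => x * y) (fun x => conjc x).

Definition quaternion_algebra (R : rcfType) : star_algebra R :=
  cayley_dickson (complex_algebra R).

Definition octonion_algebra (R : rcfType) : star_algebra R :=
  cayley_dickson (quaternion_algebra R).

Inductive division_kind := Complexes | Quaternions | Octonions.

Definition division_algebra (R : rcfType) (K : division_kind) :
    star_algebra R :=
  match K with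
  | Complexes => complex_algebra R
  | Quaternions => quaternion_algebra R
  | Octonions => octonion_algebra R
  end.

Section RootManifold.
Variables (R : nzRingType) (A : star_algebra R).
Implicit Types (x : A) (P : {poly R}).

Definition apow x (k : nat) : A := iter k (amul x) (aone A).

Definition aeval P x : A := \sum_(k < size P) P`_k *: apow x k.

Definition areal x : Prop := exists r : R, x = r *: aone A.

Definition Aut : set (A -> A) :=
  [set g : A -> A | [/\ bijective g, linear g & {morph g : x y / amul x y}]].

Definition root_manifold x : set A := [set g x | g in Aut].

End RootManifold.

Section Submanifold.
Variable R : realType.

Fixpoint Cn_on (n k : nat) (U : set 'rV[R]_n) (f : 'rV[R]_n -> R) : Prop :=
  (forall x, U x -> {for x, continuous f}) /\
  match k with
  | 0%N => True
  | k'.+1 => forall i : 'I_n,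
      (forall x, U x -> derivable f x (delta_mx 0 i)) /\
      Cn_on k' U ('D_(delta_mx 0 i) f)
  end.

Definition smooth_on (n m : nat) (U : set 'rV[R]_n)
    (f : 'rV[R]_n -> 'rV[R]_m) : Prop :=
  forall (k : nat) (j : 'I_m), Cn_on k U (fun x => f x 0 j).

Definition diffeomorphism (n : nat) (U V : set 'rV[R]_n)
    (f : 'rV[R]_n -> 'rV[R]_n) : Prop :=
  exists g : 'rV[R]_n -> 'rV[R]_n,
    [/\ f @` U = V, {in U, cancel f g}, smooth_on U f & smooth_on V g].

(* The subspace R^k x {0} of R^n. *)
Definition flat (n k : nat) : set 'rV[R]_n :=
  [set y | forall i : 'I_n, (k <= i)%N -> y 0 i = 0].

Definition submanifold_Rn (n k : nat) (M : set 'rV[R]_n) : Prop :=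
  (k <= n)%N /\
  forall p, M p -> exists U V : set 'rV[R]_n, exists f : 'rV[R]_n -> 'rV[R]_n,
    [/\ open U, open V, U p, diffeomorphism U V f &
        f @` (U `&` M) = V `&` flat k].

(* M is a smooth embedded submanifold of dimension k of the space E; this does
   not depend on the basis used to identify E with R^n. *)
Definition manifold_dim (E : vectType R) (M : set E) (k : nat) : Prop :=
  submanifold_Rn k [set passmx.rVof (vbasis {: E}) x | x in M].

End Submanifold.

(* Main.v *)
(* Every x satisfies x^2 = 2 <x, 1> x - <x, x> 1, so an automorphism, which fixes 1
   and keeps x nonreal, preserves <x, 1> and <x, x>.  Conversely Aut acts transitively
   on the nonreal elements with given <x, 1> and <x, x>: for a Cayley-Dickson double,
   (a, b) -> (a, u b) with u a unit makes b real, and permuting the imaginary units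
   moves the real b into the first component, where the argument applies again.
   So the root manifold is the sphere cut out by <x, 1> = r and <x, x> = r^2 + c with
   c > 0.  Such a sphere has codimension 2: near a point p, stereographic projection
   from the antipode of p extends to a chart of the ambient space which is rational,
   with rational inverse; rational functions without poles are smooth because partial
   derivatives of rational functions are rational. *)
From HB Require Import structures.
Require Import Defs.
From mathcomp Require Import all_boot all_order all_algebra.
From mathcomp Require Import all_classical all_reals all_analysis.
From mathcomp Require Import complex ring.
Import Order.TTheory GRing.Theory Num.Theory numFieldNormedType.Exports.

Set Implicit Arguments.
Unset Strict Implicit.
Unset Printing Implicit Defensive.

Local Open Scope classical_set_scope.
Local Open Scope ring_scope.

(** * Rational functions without poles, and their smoothness *)

Section RationalFunctions.
Variables (R : realType) (n : nat).
Implicit Types (U : set 'rV[R]_n) (f g : 'rV[R]_n -> R).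

(** An inductive closure, so that derivatives are found by induction on the expression; the premise
    of [rational_inv] rules out poles on [U]. *)
Inductive rational_on U : ('rV[R]_n -> R) -> Prop :=
| rational_cst c : rational_on U (fun=> c)
| rational_coord i : rational_on U (fun x => x 0 i)
| rational_add f g : rational_on U f -> rational_on U g ->
    rational_on U (fun x => f x + g x)
| rational_mul f g : rational_on U f -> rational_on U g ->
    rational_on U (fun x => f x * g x)
| rational_inv f : rational_on U f -> (forall x, U x -> f x != 0) ->
    rational_on U (fun x => (f x)^-1).

Lemma is_derive_coord (x v : 'rV[R]_n) i :
  is_derive x v (fun y : 'rV[R]_n => y 0 i) (v 0 i).
Proof.
have cvg_coord : (h^-1 *: (((fun y : 'rV[R]_n => y 0 i) \o shift x) (h *: v)
    - x 0 i) : R) @[h --> 0^'] --> v 0 i.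
  apply: cvg_near_cst.
  near=> h; rewrite /= !mxE addrK /GRing.scale /= mulrA mulVf ?mul1r //.
  by near: h; exact: nbhs_dnbhs_neq.
apply: DeriveDef; first by apply/cvg_ex; exists (v 0 i).
exact: cvg_lim cvg_coord.
Unshelve. all: by end_near. Qed.

Lemma rational_derive U f (v : 'rV[R]_n) : rational_on U f ->
  exists2 df, rational_on U df & forall x, U x -> is_derive x v f (df x).
Proof.
elim=> {f} [c|i|f g _ [df rdf Hf] _ [dg rdg Hg]
    |f g rf [df rdf Hf] rg [dg rdg Hg]|f rf [df rdf Hf] f0].
- by exists (fun=> 0); [exact: rational_cst | move=> x _; exact: is_derive_cst].
- exists (fun=> v 0 i); [exact: rational_cst | by move=> x _; exact: is_derive_coord].
- exists (fun x => df x + dg x); first exact: rational_add.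
  by move=> x Ux; apply: is_deriveD; [exact: Hf | exact: Hg].
- exists (fun x => f x * dg x + g x * df x).
    by apply: rational_add; apply: rational_mul.
  by move=> x Ux; apply: is_deriveM; [exact: Hf | exact: Hg].
exists (fun x => - 1 * ((f x)^-1 * (f x)^-1) * df x).
  apply: rational_mul rdf; apply: rational_mul; first exact: rational_cst.
  by apply: rational_mul; exact: rational_inv.
move=> x Ux; have [dfx dfxE] := Hf x Ux.
apply: DeriveDef; first exact: derivableV (f0 _ Ux) dfx.
rewrite deriveV ?f0 // dfxE /GRing.scale /=; congr (_ * _).
by rewrite mulN1r expr2 invfM.
Qed.

Lemma rational_continuous U f : rational_on U f ->
  forall x, U x -> {for x, continuous f}.
Proof.
elim=> {f} [c|i|f g _ Hf _ Hg|f g _ Hf _ Hg|f _ Hf f0] x Ux.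
- exact: (@cst_continuous _ _ c x).
- exact: coord_continuous.
- exact: cvgD (Hf x Ux) (Hg x Ux).
- exact: cvgM (Hf x Ux) (Hg x Ux).
- exact: cvgV (f0 x Ux) (Hf x Ux).
Qed.

Lemma eq_on_near U f g (x : 'rV[R]_n) : open U ->
  (forall y, U y -> f y = g y) -> U x -> \forall y \near x, f y = g y.
Proof.
move=> oU fg Ux; have : nbhs x U by exact: open_nbhs_nbhs.
by apply: filterS.
Qed.

(** A derivative is identified with a rational function only on [U], whereas [Cn_on] iterates on
    total functions. As [U] is open, agreement on [U] is agreement near each of its points, so
    derivatives agree as well. *)
Lemma eq_Cn_on k U f g : open U -> (forall x, U x -> f x = g x) ->
  Cn_on k U f -> Cn_on k U g.
Proof.
move=> oU; elim: k f g => [|k IH] f g fg /= [cf Hf].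
all: have near_fg x Ux := eq_on_near oU fg (Ux : U x).
all: have cg x (Ux : U x) : {for x, continuous g} by
  have := cf x Ux; rewrite /prop_for /continuous_at fg // => cfx;
  apply: cvg_trans cfx; exact: (@near_eq_cvg _ _ (nbhs x) _ f g (near_fg x Ux)).
  by [].
split=> // i; have [df Df] := Hf i; split.
  by move=> x Ux; apply: near_eq_derivable (near_fg x Ux) (df x Ux).
apply: IH Df => x Ux; exact: near_eq_derive (near_fg x Ux).
Qed.

Lemma rational_Cn_on k U f : open U -> rational_on U f -> Cn_on k U f.
Proof.
move=> oU; elim: k f => [|k IH] f rf /=.
all: split; first exact: rational_continuous.
  by [].
move=> i; have [df rdf Hdf] := rational_derive (delta_mx 0 i) rf; split.
  by move=> x /Hdf[].
by apply: eq_Cn_on (IH _ rdf) => // x /Hdf[_ ->].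
Qed.

End RationalFunctions.

(** * Rational maps into a vector space *)

Section RationalMaps.
Variables (R : realType) (n : nat).
Implicit Types (U : set 'rV[R]_n) (E : vectType R).

(** Testing against every linear form avoids choosing a basis and covers the coordinates in all
    bases at once. *)
Definition rational_map E U (F : 'rV[R]_n -> E) : Prop :=
  forall l : {scalar E}, rational_on U (fun v => l (F v)).

Lemma rational_sum U (I : finType) (f : I -> 'rV[R]_n -> R) :
  (forall i, rational_on U (f i)) -> rational_on U (fun v => \sum_i f i v).
Proof.
move=> rf; elim: index_enum => [|i s IH].
  by under eq_fun do rewrite big_nil; exact: rational_cst.
by under eq_fun do rewrite big_cons; exact: rational_add (rf i) IH.
Qed.

Lemma rational_mapD E U (F G : 'rV[R]_n -> E) :
  rational_map U F -> rational_map U G -> rational_map U (fun v => F v + G v).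
Proof.
move=> rF rG l; under eq_fun do rewrite raddfD.
exact: rational_add (rF l) (rG l).
Qed.

Lemma rational_mapZ E U f (F : 'rV[R]_n -> E) :
  rational_on U f -> rational_map U F -> rational_map U (fun v => f v *: F v).
Proof.
move=> rf rF l; under eq_fun do rewrite linearZ.
exact: rational_mul rf (rF l).
Qed.

Lemma rational_map_cst E U (x : E) : rational_map U (fun=> x).
Proof. by move=> l; exact: rational_cst. Qed.

Lemma open_rational_gt0 f : rational_on setT f -> open [set v : 'rV[R]_n | 0 < f v].
Proof.
move=> rf; rewrite (_ : [set _ | _] = f @^-1` [set x | 0 < x]) //.
apply: open_comp; last exact: open_gt.
by move=> v _; exact: rational_continuous rf v I.
Qed.

End RationalMaps.

(** * Coordinates of vectors in a basis *)

Section Coordinates.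
Variables (R : realType) (E : vectType R).
Let n := \dim {:E}.
Implicit Types (X : n.-tuple E) (U : set 'rV[R]_n).

Lemma rational_map_vecof U X : rational_map U (passmx.vecof X).
Proof.
move=> l; under eq_fun do rewrite /passmx.vecof raddf_sum /=.
apply: rational_sum => i; under eq_fun do rewrite linearZ /=.
by apply: rational_mul; [exact: rational_coord | exact: rational_cst].
Qed.

Lemma smooth_on_rVof U X (F : 'rV[R]_n -> E) : open U -> rational_map U F ->
  smooth_on U (fun v => passmx.rVof X (F v)).
Proof.
move=> oU rF k j; apply: rational_Cn_on => //.
by under eq_fun do rewrite -passmx.coord_rVof; exact: rF.
Qed.

(** A basis of [W] is continued by one of a complement; the coordinates along the complement vanish
    exactly on [W]. *)
Lemma adapted_basis (W : {vspace E}) :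
  exists2 X : n.-tuple E, basis_of {:E} X &
    forall x, x \in W <-> flat (\dim W) (passmx.rVof X x).
Proof.
have szX : size (vbasis W ++ vbasis W^C%VS) == n.
  by rewrite size_cat !size_tuple dimv_compl /n dimvf subnKC // -dimvf dimvS ?subvf.
pose X : n.-tuple E := Tuple szX.
have bX : basis_of {:E} X.
  rewrite -(addv_complf W); apply: cat_basis; try exact: vbasisP.
  by apply/directv_addP; rewrite capv_compl.
have XW (i : 'I_n) : (i < \dim W)%N -> X`_i \in W.
  move=> iW; rewrite /= nth_cat size_tuple iW.
  by apply: vbasis_mem; rewrite mem_nth ?size_tuple.
exists X => // x; split=> [xW i Wi|Wx].
  have leW : (\dim W <= n)%N by rewrite /n dimvS ?subvf.
  rewrite -passmx.coord_rVof (coord_vbasis xW) raddf_sum big1 //= => j _.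
  rewrite linearZ /= (_ : (vbasis W)`_j = X`_(widen_ord leW j)); last first.
    by rewrite /= nth_cat size_tuple ltn_ord.
  rewrite coord_free ?(basis_free bX) //.
  case: eqP => [ij|_]; last by rewrite mulr0.
  by move: Wi; rewrite leqNgt (_ : (i < \dim W)%N) // -ij /=.
rewrite -(passmx.rVofK bX x) rpred_sum // => i _.
have [Wi|iW] := leqP (\dim W) i; first by rewrite Wx // scale0r mem0v.
by rewrite memvZ ?XW.
Qed.

End Coordinates.

(** * Spheres of codimension two in a Euclidean space *)

Section Sphere.
Variables (R : realType) (E : vectType R) (dot : E -> E -> R).
Hypothesis dotC : forall x y, dot x y = dot y x.
Hypothesis dot_linear : forall y, linear_for *%R (dot^~ y).
Hypothesis dot_gt0 : forall x, x != 0 -> 0 < dot x x.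

Let dotDl y x z : dot (x + z) y = dot x y + dot z y.
Proof. by rewrite -{1}[x]scale1r dot_linear mul1r. Qed.

Let dot0l y : dot 0 y = 0.
Proof. by apply: (@addrI _ (dot 0 y)); rewrite -dotDl !addr0. Qed.

Let dotZl y a x : dot (a *: x) y = a * dot x y.
Proof. by rewrite -[a *: x]addr0 dot_linear dot0l addr0. Qed.

Let dotNl y x : dot (- x) y = - dot x y.
Proof. by rewrite -scaleN1r dotZl mulN1r. Qed.

Let dotDr y x z : dot y (x + z) = dot y x + dot y z.
Proof. by rewrite dotC dotDl !(dotC y). Qed.

Let dotZr y a x : dot y (a *: x) = a * dot y x.
Proof. by rewrite dotC dotZl dotC. Qed.

Let dot_ge0 x : 0 <= dot x x.
Proof. by have [->|/dot_gt0/ltW//] := eqVneq x 0; rewrite dot0l. Qed.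

(** Expanding [G v] in a basis leaves products of a coordinate of [G v] with a fixed linear form of
    [F v]. *)
Lemma rational_dot n (U : set 'rV[R]_n) (F G : 'rV[R]_n -> E) :
  rational_map U F -> rational_map U G ->
  rational_on U (fun v => dot (F v) (G v)).
Proof.
move=> rF rG; pose X := vbasis {:E}.
have -> : (fun v => dot (F v) (G v)) =
    fun v => \sum_i coord X i (G v) * dot (F v) X`_i.
  apply/funext => v; rewrite {1}(coord_vbasis (memvf (G v))).
  elim/big_rec2: _ => [|i a b _ <-]; first by rewrite dotC dot0l.
  by rewrite dotDr dotZr.
apply: rational_sum => i; apply: rational_mul; first exact: rG.
pose l := HB.pack_for {scalar E} (dot^~ X`_i)
  (GRing.isLinear.Build R E R *%R (dot^~ X`_i) (@dot_linear X`_i)).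
exact: (rF l).
Qed.

Section Chart.
Variables (e q : E) (r c : R).
Hypotheses (ee : dot e e = 1) (e_q0 : dot e q = 0) (qq : dot q q = c).
Hypothesis c_gt0 : 0 < c.

(** Orthogonal decomposition along [e], [q] and the complement of their span; the division by [c]
    accounts for [q] not being a unit vector. *)
Let coe y := dot y e.
Let coq y := dot y q / c.
Let perp y := y - coe y *: e - coq y *: q.

Let decE y : y = perp y + coq y *: q + coe y *: e.
Proof. by rewrite /perp addrNK addrNK. Qed.

Let perp_e y : dot (perp y) e = 0.
Proof.
by rewrite /perp !(dotDl, dotNl, dotZl) (dotC q) e_q0 ee mulr1 mulr0 oppr0 addr0 subrr.
Qed.

Let perp_q y : dot (perp y) q = 0.
Proof.
rewrite /perp !(dotDl, dotNl, dotZl) e_q0 qq mulr0 oppr0 addr0 /coq divfK ?subrr //.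
by rewrite gt_eqF.
Qed.

Section Components.
Variables (w : E) (a b : R).
Hypotheses (we : dot w e = 0) (wq : dot w q = 0).
Let y := w + b *: q + a *: e.

Let compe : coe y = a.
Proof. by rewrite /coe !(dotDl, dotZl) we (dotC q) e_q0 ee mulr0 !add0r mulr1. Qed.

Let compq : coq y = b.
Proof. by rewrite /coq !(dotDl, dotZl) wq e_q0 qq mulr0 add0r addr0 mulfK ?gt_eqF. Qed.

Let compW : perp y = w.
Proof. by rewrite /perp compe compq addrK addrK. Qed.

(** Uniqueness of the orthogonal decomposition; it reads off the components of [F y] and [G z] from
    their defining sums. *)
Lemma components_sum : [/\ coe y = a, coq y = b & perp y = w].
Proof. by []. Qed.

End Components.

Let dot_dec y : dot y y = coe y ^+ 2 + coq y ^+ 2 * c + dot (perp y) (perp y).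
Proof.
rewrite {1 2}(decE y).
move: (perp y) (coe y) (coq y) (perp_e y) (perp_q y) => w a b we wq.
rewrite !(dotDl, dotDr, dotZl, dotZr) !(dotC _ w) (dotC q e) we wq e_q0 ee qq.
ring.
Qed.

(* The sphere has centre r e and contains p = r e + q.  When <y, e> = r, the line from
   the antipode r e - q to y has direction q + w with w = (s y)^-1 *: perp y, and
   s y (c + <w, w>) - 2 c, which vanishes exactly on the sphere, is the transverse
   coordinate that F puts along q; given it and w, u recovers s y. *)
Let s y := coq y + 1.
Let F y := (s y)^-1 *: perp y
  + ((coq y - 1) * c + dot (perp y) (perp y) / s y) *: q + (coe y - r) *: e.
Let u z := (coq z + 2 * c) / (c + dot (perp z) (perp z)).
Let G z := u z *: perp z + (u z - 1) *: q + (coe z + r) *: e.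

Let F_comp y : [/\ coe (F y) = coe y - r,
  coq (F y) = (coq y - 1) * c + dot (perp y) (perp y) / s y &
  perp (F y) = (s y)^-1 *: perp y].
Proof. by apply: components_sum; rewrite dotZl ?perp_e ?perp_q mulr0. Qed.

Let G_comp z : [/\ coe (G z) = coe z + r, coq (G z) = u z - 1 &
  perp (G z) = u z *: perp z].
Proof. by apply: components_sum; rewrite dotZl ?perp_e ?perp_q mulr0. Qed.

Let den_gt0 z : 0 < c + dot (perp z) (perp z).
Proof. by rewrite ltr_wpDr. Qed.

Let u_gt0 z : 0 < coq z + 2 * c -> 0 < u z.
Proof. by move=> z0; rewrite divr_gt0. Qed.

Let uF y : 0 < s y -> u (F y) = s y.
Proof.
move=> sy; have [_ BF WF] := F_comp y.
have := den_gt0 y; have s0 : s y != 0 by rewrite gt_eqF.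
rewrite /u BF WF dotZl dotZr; have := dot_ge0 (perp y).
set d := dot _ _ => d0 _.
(* Up to the factor [s y ^+ 2], this is the denominator of [u (F y)], which [field] requires to be
   nonzero. *)
have : 0 < c * s y ^+ 2 + d by rewrite ltr_wpDr // mulr_gt0 ?exprn_gt0.
have -> : coq y = s y - 1 by rewrite /s addrK.
move: (s y) s0 => t t0 dn; field; by rewrite t0 -expr2 gt_eqF.
Qed.

Let FV y : 0 < s y -> 0 < coq (F y) + 2 * c.
Proof.
move=> sy; have := uF sy; rewrite /u => uE.
rewrite -(pmulr_lgt0 _ (_ : 0 < (c + dot (perp (F y)) (perp (F y)))^-1)).
  by rewrite uE.
by rewrite invr_gt0.
Qed.

Let FK y : 0 < s y -> G (F y) = y.
Proof.
move=> sy; have [AF _ WF] := F_comp y.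
rewrite /G uF // WF AF scalerA divff ?gt_eqF // scale1r subrK /s addrK.
by rewrite -decE.
Qed.

Let GU z : 0 < coq z + 2 * c -> 0 < s (G z).
Proof. by move=> z0; have [_ BG _] := G_comp z; rewrite /s BG subrK u_gt0. Qed.

Let GK z : 0 < coq z + 2 * c -> F (G z) = z.
Proof.
move=> z0; have [AG BG WG] := G_comp z; have := u_gt0 z0 => uz.
have sE : s (G z) = u z by rewrite /s BG subrK.
rewrite /F sE WG AG BG scalerA mulVf ?gt_eqF // scale1r addrK.
rewrite [in RHS](decE z); congr (_ + _ *: _ + _).
rewrite dotZl dotZr [LHS](_ : _ = u z * (c + dot (perp z) (perp z)) - 2 * c).
  by rewrite /u divfK ?gt_eqF // addrK.
by move: (u z) uz => t t0; field; rewrite gt_eqF.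
Qed.

(** By Pythagoras, [s y * coq (F y)] is [dot y y - coe y ^+ 2 - c]; once [coe y = r], it vanishes
    exactly on the sphere. *)
Let F_flat y : 0 < s y ->
  (dot (F y) e = 0 /\ dot (F y) q = 0) <-> (dot y e = r /\ dot y y = r ^+ 2 + c).
Proof.
move=> sy; have [AF BF _] := F_comp y; have s0 : s y != 0 by rewrite gt_eqF.
have -> : dot (F y) q = coq (F y) * c by rewrite /coq divfK ?gt_eqF.
have BFE : coq (F y) = (dot y y - coe y ^+ 2 - c) / s y.
  rewrite BF (dot_dec y) (_ : coq y = s y - 1); first by move: (s y) s0 => t t0; field.
  by rewrite /s addrK.
rewrite -/(coe (F y)) -/(coe y) AF BFE; split=> [[]|[-> ->]].
  move=> /eqP; rewrite subr_eq0 => /eqP Ay; rewrite Ay => /eqP.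
  rewrite !mulf_eq0 invr_eq0 (negPf s0) (gt_eqF c_gt0) !orbF => /eqP H.
  by split=> //; apply/eqP; rewrite -subr_eq0 opprD addrA H.
by rewrite subrr [_ + c]addrC addrK subrr !mul0r.
Qed.

Section Rational.
Variables (n : nat) (U : set 'rV[R]_n) (f : 'rV[R]_n -> E).
Hypothesis rf : rational_map U f.

Let rational_coe : rational_on U (fun v => coe (f v)).
Proof. exact: rational_dot rf (rational_map_cst _ _). Qed.

Lemma rational_coq : rational_on U (fun v => dot (f v) q / c).
Proof.
exact: rational_mul (rational_dot rf (rational_map_cst _ _)) (rational_cst _ _).
Qed.

Let rational_perp : rational_map U (fun v => perp (f v)).
Proof.
(* The closure rules speak of sums and products only, so differences become sums with multiples by
   -1. *)
have -> : (fun v => perp (f v)) =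
    fun v => (f v + (-1 * coe (f v)) *: e) + (-1 * coq (f v)) *: q.
  by apply/funext => v; rewrite !mulN1r !scaleNr.
apply: rational_mapD; [apply: rational_mapD => //|].
  apply: rational_mapZ (rational_map_cst _ _).
  exact: rational_mul (rational_cst _ _) rational_coe.
apply: rational_mapZ (rational_map_cst _ _).
exact: rational_mul (rational_cst _ _) rational_coq.
Qed.

Let rational_perp2 : rational_on U (fun v => dot (perp (f v)) (perp (f v))).
Proof. exact: rational_dot. Qed.

Lemma rational_chart : (forall v, U v -> 0 < s (f v)) ->
  rational_map U (fun v => F (f v)).
Proof.
move=> s_gt0.
have rs : rational_on U (fun v => (s (f v))^-1).
  apply: rational_inv => [|v /s_gt0]; last by move=> /gt_eqF ->.
  exact: rational_add rational_coq (rational_cst _ _).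
apply: rational_mapD; first apply: rational_mapD.
- exact: rational_mapZ rs rational_perp.
- apply: rational_mapZ (rational_map_cst _ _).
  apply: rational_add (rational_mul rational_perp2 rs).
  apply: rational_mul (rational_cst _ _).
  exact: rational_add rational_coq (rational_cst _ _).
apply: rational_mapZ (rational_map_cst _ _).
exact: rational_add rational_coe (rational_cst _ _).
Qed.

Lemma rational_chart_inv : rational_map U (fun v => G (f v)).
Proof.
have ru : rational_on U (fun v => u (f v)).
  apply: rational_mul; first exact: rational_add rational_coq (rational_cst _ _).
  apply: rational_inv => [|v _]; last by rewrite gt_eqF.
  exact: rational_add (rational_cst _ _) rational_perp2.
apply: rational_mapD; first apply: rational_mapD.
- exact: rational_mapZ ru rational_perp.
- apply: rational_mapZ (rational_map_cst _ _).
  exact: rational_add ru (rational_cst _ _).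
apply: rational_mapZ (rational_map_cst _ _).
exact: rational_add rational_coe (rational_cst _ _).
Qed.

End Rational.

(** [W] is the kernel of the pairing with [e] and [q], which is onto R^2 because these are
    orthogonal and nonzero; rank-nullity gives the dimension. *)
Lemma perp_space :
  exists2 W : {vspace E}, (\dim {:E} = \dim W + 2)%N &
    forall x, x \in W <-> dot x e = 0 /\ dot x q = 0.
Proof.
pose p x : 'rV[R]_2 := \row_i dot x (if i == 0 then e else q).
have p_lin : linear p by move=> a x y; apply/rowP => i; rewrite !mxE dot_linear.
pose f := linfun (HB.pack_for {linear E -> 'rV[R]_2} p
  (GRing.isLinear.Build R E 'rV[R]_2 *:%R p p_lin)).
have fE x : f x = p x by rewrite lfunE.
exists (lker f); last first.
  move=> x; rewrite memv_ker fE; split=> [/eqP/rowP px|[xe xq]].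
    by have := (px 0, px 1); rewrite !mxE /= => -[].
  by apply/eqP/rowP => i; rewrite !mxE; case: ifP.
rewrite -(limg_ker_dim f fullv) capfv; congr (_ + _)%N.
suff -> : (f @: fullv = fullv)%VS by rewrite dimvf dim_matrix.
apply/eqP; rewrite eqEsubv subvf /=; apply/subvP => v _.
(* A preimage of [v]; the coefficient along [q] is divided by [dot q q = c]. *)
suff -> : v = f (v 0 0 *: e + (v 0 1 / c) *: q) by rewrite memv_img ?memvf.
rewrite fE; apply/rowP => i; rewrite !mxE !(dotDl, dotZl).
have [->|i0] := eqVneq i 0.
  by rewrite ee (dotC q) e_q0 mulr1 mulr0 addr0.
rewrite e_q0 qq mulr0 add0r divfK ?gt_eqF //; congr (v 0 _).
by apply/val_inj; case: i i0 => [[|[]]].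
Qed.

(** The source uses the basis prescribed by [manifold_dim], the target a basis adapted to the
    orthogonal complement of [e] and [q], in which flatness means orthogonality to both. *)
Lemma sphere_chart : exists U V : set 'rV[R]_(\dim {:E}),
    exists f : 'rV[R]_(\dim {:E}) -> 'rV[R]_(\dim {:E}),
  [/\ open U, open V, U (passmx.rVof (vbasis {:E}) (q + r *: e)),
     diffeomorphism U V f &
     f @` (U `&` [set passmx.rVof (vbasis {:E}) x | x in
        [set x | dot x e = r /\ dot x x = r ^+ 2 + c]]) =
     V `&` flat (\dim {:E} - 2)].
Proof.
have [W dimW WE] := perp_space; have [Y bY YW] := adapted_basis W.
have -> : (\dim {:E} - 2 = \dim W)%N by rewrite dimW addnK.
set X := vbasis _.
have bX : basis_of {:E} X := vbasisP _.
(* [s] vanishes at the antipode and is 2 at the centre of the chart; [V] is the half-space where [u]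
   is positive, and it is the image of [U]. *)
pose U := [set v | 0 < s (passmx.vecof X v)].
pose V := [set v | 0 < coq (passmx.vecof Y v) + 2 * c].
have oU : open U.
  apply: open_rational_gt0; apply: rational_add (rational_cst _ _).
  exact/rational_coq/rational_map_vecof.
have oV : open V.
  apply: open_rational_gt0; apply: rational_add (rational_cst _ _).
  exact/rational_coq/rational_map_vecof.
pose f v := passmx.rVof Y (F (passmx.vecof X v)).
pose g v := passmx.rVof X (G (passmx.vecof Y v)).
have fV v : U v -> V (f v)
  by move=> Uv; rewrite /V /f /= passmx.rVofK //; exact: FV.
have gU v : V v -> U (g v)
  by move=> Vv; rewrite /U /g /= passmx.rVofK //; exact: GU.
have fK v : U v -> g (f v) = v
  by move=> Uv; rewrite /g /f passmx.rVofK // FK // passmx.vecofK.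
have gK v : V v -> f (g v) = v
  by move=> Uv; rewrite /g /f passmx.rVofK // GK // passmx.vecofK.
exists U, V, f; split=> //.
- by rewrite /U /= passmx.rVofK // /s /coq dotDl dotZl e_q0 qq mulr0 addr0
    divff ?gt_eqF.
- exists g; split.
  + apply/seteqP; split=> [_ [v Uv <-]|v Vv]; first exact: fV.
    by exists (g v); [exact: gU | exact: gK].
  + by move=> v; rewrite inE; exact: fK.
  + by apply: smooth_on_rVof => //; apply: rational_chart => //;
      exact: rational_map_vecof.
  + by apply: smooth_on_rVof => //; apply: rational_chart_inv => //;
      exact: rational_map_vecof.
have flatE v : U v -> flat (\dim W) (f v) <->
    dot (passmx.vecof X v) e = r /\
    dot (passmx.vecof X v) (passmx.vecof X v) = r ^+ 2 + c.
  by move=> Uv; rewrite -F_flat // -WE YW.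
apply/seteqP; split=> [_ [v [Uv [x Mx xv]] <-]|v [Vv flatv]].
  by split; [exact: fV | apply/flatE; rewrite -?xv ?passmx.rVofK // xv].
exists (g v); last exact: gK.
split; first exact: gU.
exists (passmx.vecof X (g v)); last by rewrite passmx.vecofK.
by apply/flatE; [exact: gU | rewrite gK].
Qed.

End Chart.

Lemma sphere_manifold (e : E) (r c : R) : dot e e = 1 -> 0 < c ->
  manifold_dim [set x | dot x e = r /\ dot x x = r ^+ 2 + c] (\dim {:E} - 2).
Proof.
move=> ee c_gt0; split; first exact: leq_subr.
(* Each point is the centre of its own chart, with [q] its component orthogonal to [e]. *)
move=> _ [x [xe xx] <-]; pose q := x - r *: e.
have e_q0 : dot e q = 0 by rewrite dotC dotDl dotNl dotZl ee xe mulr1 subrr.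
have qq : dot q q = c.
  rewrite {2}/q dotDr dotC -scaleNr dotZr (dotC q) e_q0 mulr0 addr0 /q.
  by rewrite dotDr -scaleNr dotZr xe xx; ring.
rewrite (_ : x = q + r *: e); last by rewrite subrK.
exact: sphere_chart.
Qed.

End Sphere.

(** * Real and imaginary parts, reducing identities in the algebras to real ones *)

Section RealCoordinates.
Variable R : rcfType.
Implicit Types x y : Rcomplex R.

Lemma ReD x y : complex.Re (x + y) = complex.Re x + complex.Re y.
Proof. by case: x y => a b []. Qed.
Lemma ImD x y : complex.Im (x + y) = complex.Im x + complex.Im y.
Proof. by case: x y => a b []. Qed.
Lemma ReN x : complex.Re (- x) = - complex.Re x.
Proof. by case: x. Qed.
Lemma ImN x : complex.Im (- x) = - complex.Im x.
Proof. by case: x. Qed.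
Lemma ReZ a x : complex.Re (a *: x) = a * complex.Re x.
Proof. by case: x. Qed.
Lemma ImZ a x : complex.Im (a *: x) = a * complex.Im x.
Proof. by case: x. Qed.
Lemma ReM x y : complex.Re (x * y) =
  complex.Re x * complex.Re y - complex.Im x * complex.Im y.
Proof. by case: x y => a b []. Qed.
Lemma ImM x y : complex.Im (x * y) =
  complex.Re x * complex.Im y + complex.Im x * complex.Re y.
Proof. by case: x y => a b []. Qed.
Lemma ReJ x : complex.Re (conjc x) = complex.Re x.
Proof. by case: x. Qed.
Lemma ImJ x : complex.Im (conjc x) = - complex.Im x.
Proof. by case: x. Qed.
Lemma Re0 : complex.Re (0 : Rcomplex R) = 0. Proof. by []. Qed.
Lemma Im0 : complex.Im (0 : Rcomplex R) = 0. Proof. by []. Qed.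
Lemma Re1 : complex.Re (1 : Rcomplex R) = 1. Proof. by []. Qed.
Lemma Im1 : complex.Im (1 : Rcomplex R) = 0. Proof. by []. Qed.

Lemma eq_Rcomplex x y :
  complex.Re x = complex.Re y -> complex.Im x = complex.Im y -> x = y.
Proof. by case: x y => a b [c d] /= -> ->. Qed.

Definition coordE := (ReD, ImD, ReN, ImN, ReZ, ImZ, ReM, ImM, ReJ, ImJ,
  Re0, Im0, Re1, Im1).

End RealCoordinates.

Lemma eq_pair2 (S T : Type) (x y : S * T) : x.1 = y.1 -> x.2 = y.2 -> x = y.
Proof. by case: x y => a b [c d] /= -> ->. Qed.

(** * Automorphisms commuting with the conjugation, and their orbits *)

Section StarAutomorphisms.
Variables (R : rcfType) (A : star_algebra R).
Implicit Types (x y z : A) (g : A -> A).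

Definition star_aut g := Aut g /\ {morph g : x / aconj x}.

(* Commutation with the conjugation is what lets an automorphism of an algebra
   extend to its Cayley-Dickson double. *)
Definition same_orbit x y : Prop := exists2 g, star_aut g & g x = y.

Lemma Aut_linear g : Aut g -> exists h : {linear A -> A}, g = h.
Proof.
case=> _ gL _.
by exists (HB.pack_for {linear A -> A} g (GRing.isLinear.Build R A A *:%R g gL)).
Qed.

Lemma star_aut_can g g' : cancel g g' -> cancel g' g -> linear g ->
  {morph g : x y / amul x y} -> {morph g : x / aconj x} -> star_aut g.
Proof. by move=> gK g'K gL gM gJ; do !split=> //; exists g'. Qed.

Lemma same_orbit_sym x y : same_orbit x y -> same_orbit y x.
Proof.
case=> g [[[h gK hK] gL gM] gJ] <-; exists h; last exact: gK.
apply: (star_aut_can hK gK).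
- by move=> a u v; apply: (can_inj gK); rewrite gL !hK.
- by move=> u v; apply: (can_inj gK); rewrite gM !hK.
- by move=> u; apply: (can_inj gK); rewrite gJ !hK.
Qed.

Lemma same_orbit_trans x y z : same_orbit x y -> same_orbit y z -> same_orbit x z.
Proof.
case=> g [[gb gL gM] gJ] <- [h [[hb hL hM] hJ] <-]; exists (h \o g) => //.
split; last by move=> u; rewrite /= gJ hJ.
split; first exact: bij_comp.
- by move=> a u v; rewrite /= gL hL.
- by move=> u v; rewrite /= gM hM.
Qed.

(** As [g] is onto, [g (aone A)] is a left unit of the whole algebra; its product with [aone A] is
    then equal to both. *)
Lemma Aut_one g : (forall x, amul (aone A) x = x) ->
  (forall x, amul x (aone A) = x) -> Aut g -> g (aone A) = aone A.
Proof.
move=> mul1l mul1r [[h _ hK] _ gM].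
by rewrite -[LHS]mul1r -{2}(hK (aone A)) -gM mul1l hK.
Qed.

End StarAutomorphisms.

(** * Automorphisms of a Cayley-Dickson double *)

Section CayleyDickson.
Variables (R : rcfType) (A : star_algebra R).

Hypothesis amul1l : forall x : A, amul (aone A) x = x.
Hypothesis amul1r : forall x : A, amul x (aone A) = x.

(** Applying [g] to both components respects the operations of the double, which are built from
    sums, products and conjugates in [A]; a real second component is fixed because [g] fixes 1. *)
Lemma same_orbit_pair (a b : A) (k : R) : same_orbit a b ->
  same_orbit (A := cayley_dickson A) (a, k *: aone A) (b, k *: aone A).
Proof.
case=> g gA <-; have := gA => -[gAut gJ].
have [[g' gK g'K] gL gM] := gAut; have [h gh] := Aut_linear gAut.
exists (fun x => (g x.1, g x.2)); last first.
  by rewrite /= gh linearZ /= -gh Aut_one.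
apply: (@star_aut_can _ (cayley_dickson A) _
  (fun x => (g' x.1, g' x.2))).
- by move=> [x y] /=; rewrite !gK.
- by move=> [x y] /=; rewrite !g'K.
- by move=> l x y; apply: eq_pair2; rewrite /= gL.
- by move=> x y; apply: eq_pair2; rewrite /= -!(gM, gJ) gh ?raddfB ?raddfD.
- by move=> x; apply: eq_pair2; rewrite /= ?gJ // gh raddfN.
Qed.

End CayleyDickson.

(** The associative algebras to be doubled, instantiated by the complex numbers and the quaternions;
    [N] is the square of the norm. *)
Record normed_star_algebra (R : rcfType) (A : star_algebra R) (N : A -> R) : Prop :=
  NormedStarAlgebra {
  amul1l : forall x : A, amul (aone A) x = x;
  amul1r : forall x : A, amul x (aone A) = x;
  amulA : forall x y z : A, amul x (amul y z) = amul (amul x y) z;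
  amul_linearl : forall y : A, linear (amul^~ y);
  amul_linearr : forall x : A, linear (amul x);
  aconj_linear : linear (@aconj R A);
  aconjM : forall x y : A, aconj (amul x y) = amul (aconj y) (aconj x);
  aconjK : involutive (@aconj R A);
  amul_conjl : forall x, amul (aconj x) x = N x *: aone A;
  amul_conjr : forall x, amul x (aconj x) = N x *: aone A;
  norm_gt0 : forall x, x != 0 -> 0 < N x }.

Section NormedStarAlgebra.
Variables (R : rcfType) (A : star_algebra R) (N : A -> R).
Hypothesis AN : normed_star_algebra N.

Lemma scalable_of_linear (U V : lmodType R) (f : U -> V) :
  linear f -> forall k x, f (k *: x) = k *: f x.
Proof.
move=> fL k x.
have f0 : f 0 = 0 by have := fL (-1) 0 0; rewrite scaler0 addr0 scaleN1r addNr.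
by rewrite -[k *: x]addr0 fL f0 addr0.
Qed.

Lemma additive_of_linear (U V : lmodType R) (f : U -> V) :
  linear f -> {morph f : x y / x + y}.
Proof. by move=> fL x y; have := fL 1 x y; rewrite !scale1r. Qed.

Let amulZl k x y : amul (k *: x) y = k *: amul x y :> A.
Proof. exact: (scalable_of_linear (amul_linearl AN y)). Qed.
Let amulZr k x y : amul x (k *: y) = k *: amul x y :> A.
Proof. exact: (scalable_of_linear (amul_linearr AN x)). Qed.
Let amulDr (x y z : A) : amul x (y + z) = amul x y + amul x z.
Proof. exact: (additive_of_linear (amul_linearr AN x)). Qed.

Lemma aconj1 : aconj (aone A) = aone A.
Proof.
have := aconjM AN (aconj (aone A)) (aone A).
by rewrite (aconjK AN) !(amul1r AN) (aconjK AN).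
Qed.

(** The map (a, b) -> (a, u b) is multiplicative: (u d)^* (u b) = d^* (u^* u) b = d^* b by
    associativity, and u factors out of u d a + u b c^* on the left. *)
Lemma same_orbit_mul2 (u a b : A) :
  amul (aconj u) u = aone A -> amul u (aconj u) = aone A ->
  same_orbit (A := cayley_dickson A) (a, b) (a, amul u b).
Proof.
move=> uu' u'u; exists (fun x => (x.1, amul u x.2)) => //.
apply: (@star_aut_can _ (cayley_dickson A) _
  (fun x => (x.1, amul (aconj u) x.2))).
- by move=> [x y] /=; rewrite (amulA AN) uu' (amul1l AN).
- by move=> [x y] /=; rewrite (amulA AN) u'u (amul1l AN).
- by move=> k x y; apply: eq_pair2; [by [] | exact: (amul_linearr AN)].
- move=> x y; apply: eq_pair2 => /=.
    by rewrite (aconjM AN) -(amulA AN) (amulA AN (aconj u)) uu' (amul1l AN).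
  by rewrite amulDr !(amulA AN).
- move=> x; apply: eq_pair2; first by [].
  by rewrite /= -[- x.2]scaleN1r amulZr scaleN1r.
Qed.

Lemma same_orbit_norm2 (a b : A) :
  same_orbit (A := cayley_dickson A) (a, b) (a, Num.sqrt (N b) *: aone A).
Proof.
have [->|/(norm_gt0 AN) b_gt0] := eqVneq b 0.
  have N0 : N 0 *: aone A = 0.
    by rewrite -(amul_conjr AN) -[0 in LHS](scale0r (0 : A)) amulZl scale0r.
  suff -> : Num.sqrt (N 0) *: aone A = amul (aone A) 0.
    by apply: same_orbit_mul2; rewrite aconj1 (amul1l AN).
  rewrite (amul1l AN); move/eqP: N0; rewrite scaler_eq0.
  (* Either [N 0 = 0] or [aone A = 0], and both make the target zero. *)
  by case/orP=> /eqP ->; rewrite ?sqrtr0 ?scale0r ?scaler0.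
have s0 : Num.sqrt (N b) != 0 by rewrite sqrtr_eq0 -ltNge.
have sN : N b = Num.sqrt (N b) ^+ 2 by rewrite sqr_sqrtr // ltW.
have conjZ := scalable_of_linear (aconj_linear AN).
set k := Num.sqrt (N b) in s0 sN *.
(* The unit is u = b^* / |b|, for which u b = |b|. *)
have -> : k *: aone A = amul (k^-1 *: aconj b) b.
  by rewrite amulZl (amul_conjl AN) scalerA sN expr2 mulKf.
apply: same_orbit_mul2; rewrite conjZ (aconjK AN) amulZl amulZr scalerA.
  by rewrite (amul_conjr AN) scalerA sN -invfM -expr2 mulVf ?expf_neq0 // scale1r.
by rewrite (amul_conjl AN) scalerA sN -invfM -expr2 mulVf ?expf_neq0 // scale1r.
Qed.

End NormedStarAlgebra.

(** * Euclidean inner products on the three algebras *)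

Section Concrete.
Variable R : rcfType.

Definition complex_inner (x y : complex_algebra R) : R :=
  complex.Re x * complex.Re y + complex.Im x * complex.Im y.

Definition pair_inner (A : star_algebra R) (d : A -> A -> R)
  (x y : cayley_dickson A) : R := d x.1 y.1 + d x.2 y.2.

Definition inner (K : division_kind) :
    division_algebra R K -> division_algebra R K -> R :=
  match K with
  | Complexes => complex_inner
  | Quaternions => pair_inner complex_inner
  | Octonions => pair_inner (pair_inner complex_inner)
  end.

End Concrete.

(** * Invariants and transitivity of the automorphism groups *)

Section Transitivity.
Variable R : rcfType.

Ltac coordinates := repeat apply: eq_pair2; apply: eq_Rcomplex;
  rewrite /= ?coordE /pair_inner /complex_inner /=; ring.

Lemma complex_inner_gt0 (x : complex_algebra R) : x != 0 -> 0 < complex_inner x x.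
Proof.
move=> x0; rewrite lt_neqAle eq_sym /complex_inner -!expr2 addr_ge0 ?sqr_ge0 // andbT.
apply: contra x0; rewrite paddr_eq0 ?sqr_ge0 // !sqrf_eq0 => /andP[/eqP a0 /eqP b0].
exact/eqP/eq_Rcomplex.
Qed.

Lemma pair_inner_gt0 (A : star_algebra R) (d : A -> A -> R) :
  (forall x, x != 0 -> 0 < d x x) -> d 0 0 = 0 ->
  forall x : cayley_dickson A, x != 0 -> 0 < pair_inner d x x.
Proof.
move=> d_gt0 d0.
have d_ge0 x : 0 <= d x x by have [->|/d_gt0/ltW//] := eqVneq x 0; rewrite d0.
case=> a b; have [->|/d_gt0 a0 _] := eqVneq a 0; last by rewrite ltr_wpDr.
have [->|/d_gt0 b0 _] := eqVneq b 0; last by rewrite ltr_wpDl.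
by rewrite eqxx.
Qed.

Lemma innerC K (x y : division_algebra R K) : inner x y = inner y x.
Proof.
by case: K x y => x y; rewrite /= /pair_inner /complex_inner; ring.
Qed.

Lemma inner_linear K (y : division_algebra R K) : linear_for *%R ((@inner R K)^~ y).
Proof.
by case: K y => y k x z; rewrite /= /pair_inner /complex_inner /= ?coordE; ring.
Qed.

Lemma inner_gt0 K (x : division_algebra R K) : x != 0 -> 0 < inner x x.
Proof.
have c0 : complex_inner (0 : complex_algebra R) 0 = 0.
  by rewrite /complex_inner /= mulr0 addr0.
case: K x => [|x|x]; first exact: complex_inner_gt0.
  exact: pair_inner_gt0 complex_inner_gt0 c0 x.
apply: pair_inner_gt0 => [y|]; last by rewrite /pair_inner /= c0 addr0.
exact: pair_inner_gt0 complex_inner_gt0 c0 y.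
Qed.

Lemma inner1 K : inner (aone (division_algebra R K)) (aone (division_algebra R K)) = 1.
Proof. by case: K; rewrite /= /pair_inner /complex_inner /=; ring. Qed.

Lemma division_mul1l K (x : division_algebra R K) : amul (aone _) x = x.
Proof.
by case: K x => [[? ?]|[[? ?] [? ?]]|[[[? ?] [? ?]] [[? ?] [? ?]]]]; coordinates.
Qed.

Lemma division_mul1r K (x : division_algebra R K) : amul x (aone _) = x.
Proof.
by case: K x => [[? ?]|[[? ?] [? ?]]|[[[? ?] [? ?]] [[? ?] [? ?]]]]; coordinates.
Qed.

Lemma amul_self K (x : division_algebra R K) :
  amul x x = (2 * inner x (aone _)) *: x - inner x x *: aone _.
Proof.
by case: K x => [[? ?]|[[? ?] [? ?]]|[[[? ?] [? ?]] [[? ?] [? ?]]]]; coordinates.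
Qed.

Lemma normed_complex :
  normed_star_algebra (fun x : complex_algebra R => complex_inner x x).
Proof.
split; last exact: complex_inner_gt0.
- by case=> ? ?; coordinates.
- by case=> ? ?; coordinates.
- by move=> [? ?] [? ?] [? ?]; coordinates.
- by move=> [? ?] k [? ?] [? ?]; coordinates.
- by move=> [? ?] k [? ?] [? ?]; coordinates.
- by move=> k [? ?] [? ?]; coordinates.
- by move=> [? ?] [? ?]; coordinates.
- by case=> ? ?; coordinates.
- by case=> ? ?; coordinates.
- by case=> ? ?; coordinates.
Qed.

Lemma normed_quaternion :
  normed_star_algebra (fun x : division_algebra R Quaternions => inner x x).
Proof.
split; last exact: (@inner_gt0 Quaternions).
- exact: (@division_mul1l Quaternions).
- exact: (@division_mul1r Quaternions).
- by move=> [[? ?] [? ?]] [[? ?] [? ?]] [[? ?] [? ?]]; coordinates.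
- by move=> [[? ?] [? ?]] k [[? ?] [? ?]] [[? ?] [? ?]]; coordinates.
- by move=> [[? ?] [? ?]] k [[? ?] [? ?]] [[? ?] [? ?]]; coordinates.
- by move=> k [[? ?] [? ?]] [[? ?] [? ?]]; coordinates.
- by move=> [[? ?] [? ?]] [[? ?] [? ?]]; coordinates.
- by move=> [[? ?] [? ?]]; coordinates.
- by move=> [[? ?] [? ?]]; coordinates.
- by move=> [[? ?] [? ?]]; coordinates.
Qed.

(* i -> j -> k -> i, where j = (0, 1) and k = i j = (0, i). *)
Definition quaternion_cycle (x : quaternion_algebra R) : quaternion_algebra R :=
  ((complex.Re x.1 +i* complex.Im x.2)%C, (complex.Im x.1 +i* complex.Re x.2)%C).

Lemma star_aut_cycle : star_aut quaternion_cycle.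
Proof.
apply: (@star_aut_can _ (quaternion_algebra R) _
  (fun x => quaternion_cycle (quaternion_cycle x))).
- by move=> x; coordinates.
- by move=> x; coordinates.
- by move=> k x y; coordinates.
- by move=> x y; coordinates.
- by move=> x; coordinates.
Qed.

Lemma same_orbit_quaternion_cycle (x : quaternion_algebra R) :
  same_orbit x (quaternion_cycle x).
Proof. by exists quaternion_cycle => //; exact: star_aut_cycle. Qed.

(** Making the second component real removes the k part; the cycle turns the i and j parts into j
    and k parts, so that the first component is real; making the second component real again leaves
    only a real part and a j part. *)
Lemma same_orbit_quaternion_normal (x : division_algebra R Quaternions) :
  same_orbit x ((inner x (aone _))%:C%C,
             (Num.sqrt (inner x x - inner x (aone _) ^+ 2))%:C%C).
Proof.
case: x => a b; have := same_orbit_norm2 normed_complex a b.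
move=> /same_orbit_trans; apply.
apply: same_orbit_trans (same_orbit_quaternion_cycle _) _.
set y := quaternion_cycle _.
have := same_orbit_norm2 normed_complex y.1 y.2; rewrite [(y.1, y.2)](_ : _ = y) //.
have b_ge0 : 0 <= complex_inner b b.
  by rewrite addr_ge0 // -expr2 sqr_ge0.
suff -> : (y.1, Num.sqrt (complex_inner y.2 y.2) *: aone (complex_algebra R)) =
  ((inner ((a, b) : division_algebra R Quaternions) (aone _))%:C%C,
   (Num.sqrt (inner ((a, b) : division_algebra R Quaternions) (a, b) -
      inner ((a, b) : division_algebra R Quaternions) (aone _) ^+ 2))%:C%C) by [].
have -> : complex_inner y.2 y.2 = inner ((a, b) : division_algebra R Quaternions) (a, b) -
      inner ((a, b) : division_algebra R Quaternions) (aone _) ^+ 2.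
  rewrite {1}/complex_inner /= ?coordE /= !mulr1 -[X in _ + X]expr2 sqr_sqrtr //.
  by rewrite /pair_inner /complex_inner /=; ring.
by coordinates.
Qed.

Lemma same_orbit_quaternions (x y : division_algebra R Quaternions) :
  inner x (aone _) = inner y (aone _) -> inner x x = inner y y -> same_orbit x y.
Proof.
move=> r n; apply: same_orbit_trans (same_orbit_quaternion_normal x) _.
rewrite r n; exact/same_orbit_sym/same_orbit_quaternion_normal.
Qed.

(* Exchanges j = ((0, 1), (0, 0)) and l = ((0, 0), (1, 0)) and fixes the complex
   numbers; it maps j l to l j = - j l, whence the sign. *)
Definition octonion_swap (x : octonion_algebra R) : octonion_algebra R :=
  ((x.1.1, x.2.1), (x.1.2, - x.2.2)).

Lemma star_aut_swap : star_aut octonion_swap.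
Proof.
apply: (@star_aut_can _ (octonion_algebra R) _ octonion_swap).
- by move=> [[[? ?] [? ?]] [[? ?] [? ?]]]; coordinates.
- by move=> [[[? ?] [? ?]] [[? ?] [? ?]]]; coordinates.
- by move=> k [[[? ?] [? ?]] [[? ?] [? ?]]] [[[? ?] [? ?]] [[? ?] [? ?]]]; coordinates.
- by move=> [[[? ?] [? ?]] [[? ?] [? ?]]] [[[? ?] [? ?]] [[? ?] [? ?]]]; coordinates.
- by move=> [[[? ?] [? ?]] [[? ?] [? ?]]]; coordinates.
Qed.

(** The second component is made real, equal to [beta]; a quaternion automorphism takes the first to
    r + rho i, where [rho] is the norm of its imaginary part; the swap then brings [beta] into the
    quaternions, giving r + rho i + beta j. *)
Lemma same_orbit_octonion_quaternion (x : division_algebra R Octonions) :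
  exists y : division_algebra R Quaternions,
  [/\ inner x (aone _) = inner y (aone _), inner x x = inner y y &
    same_orbit x ((y, 0) : division_algebra R Octonions)].
Proof.
case: x => p b; pose r := complex.Re p.1.
pose rho := Num.sqrt (inner (p : division_algebra R Quaternions) p - r ^+ 2).
pose beta := Num.sqrt (inner (b : division_algebra R Quaternions) b).
have b_ge0 : 0 <= inner (b : division_algebra R Quaternions) b.
  by rewrite !addr_ge0 // -expr2 sqr_ge0.
have betaE : beta ^+ 2 = inner (b : division_algebra R Quaternions) b.
  by rewrite sqr_sqrtr.
have rhoE : rho ^+ 2 = inner (p : division_algebra R Quaternions) p - r ^+ 2.
  rewrite sqr_sqrtr // /= /pair_inner /complex_inner /r.
  rewrite (_ : _ - _ = complex.Im p.1 ^+ 2 + complex.Re p.2 ^+ 2 + complex.Im p.2 ^+ 2).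
    by rewrite !addr_ge0 ?sqr_ge0.
  by ring.
exists ((r +i* rho)%C, beta%:C%C); split.
- by rewrite /= /pair_inner /complex_inner /= /r; ring.
- rewrite /= /pair_inner in betaE rhoE *.
  rewrite -betaE -[X in X + _](subrK (r ^+ 2)) -rhoE /complex_inner /=; ring.
have := same_orbit_norm2 normed_quaternion p b.
rewrite [Num.sqrt _](_ : _ = beta) //; move=> /same_orbit_trans; apply.
pose p' : quaternion_algebra R := ((r +i* rho)%C, 0).
have pp' : same_orbit p p'.
  apply: same_orbit_quaternions.
    by rewrite /= /pair_inner /complex_inner /= /r; ring.
  rewrite -[LHS](subrK (r ^+ 2)) -rhoE.
  by rewrite /= /pair_inner /complex_inner /=; ring.
apply: same_orbit_trans (same_orbit_pair (@division_mul1l Quaternions)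
  (@division_mul1r Quaternions) _ pp') _.
exists octonion_swap; first exact: star_aut_swap.
move: rho beta {betaE rhoE} @p' pp' => rho beta p' _; coordinates.
Qed.

Lemma same_orbitP K (x y : division_algebra R K) :
  inner x (aone _) = inner y (aone _) -> inner x x = inner y y -> same_orbit x y.
Proof.
case: K x y; [|exact: same_orbit_quaternions|].
  move=> x y; rewrite /= /complex_inner /= !mulr1 !mulr0 !addr0 => xy.
  (* Real parts being equal, the imaginary parts agree up to sign, so the identity or the
     conjugation serves. *)
  rewrite xy => /addrI/eqP; rewrite -!expr2 eqf_sqr => /orP[]/eqP xy'.
    have -> : x = y by exact: eq_Rcomplex.
    exists id => //; exact: (@star_aut_can _ (complex_algebra R) _ id).
  exists (fun z : complex_algebra R => conjc z); last first.
    by apply: eq_Rcomplex; rewrite coordE // xy' opprK.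
  apply: (@star_aut_can _ (complex_algebra R) _ (fun z => conjc z)).
  - by move=> z; coordinates.
  - by move=> z; coordinates.
  - by move=> k z t; coordinates.
  - by move=> z t; coordinates.
  - by move=> z; coordinates.
move=> x y r n.
have [x' [rx nx sx]] := same_orbit_octonion_quaternion x.
have [y' [ry ny sy]] := same_orbit_octonion_quaternion y.
have xy' : same_orbit x' y' by apply: same_orbit_quaternions; rewrite -?rx -?nx -?ry -?ny.
apply: same_orbit_trans sx _; apply: same_orbit_trans (same_orbit_sym sy).
(* Quaternion automorphisms extend to the octonions and fix the second component 0, here the
   multiple of 1 by the scalar 0. *)
have := same_orbit_pair (@division_mul1l Quaternions)
  (@division_mul1r Quaternions) 0 xy'.
by rewrite scale0r.
Qed.

(** Comparing the quadratic equation of [g x] with the image under [g] of that of [x] gives 2 (a -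
    a') g x = (b - b') 1. If a and a' differed, [g x] and hence [x] would be real; so a = a', and b
    = b' as 1 is nonzero. *)
Lemma inner_Aut K (g : division_algebra R K -> division_algebra R K) x :
  Aut g -> ~ areal x ->
  inner (g x) (aone _) = inner x (aone _) /\ inner (g x) (g x) = inner x x.
Proof.
move=> gAut x_nonreal; have [h gh] := Aut_linear gAut.
have g1 := Aut_one (@division_mul1l K) (@division_mul1r K) gAut.
have [gb _ gM] := gAut; set e := aone _ in g1 *.
have e0 : e != 0.
  apply/eqP => e0; have := inner_linear e (-1) e e.
  rewrite mulN1r addNr scaleN1r addNr -e0 inner1 => /eqP.
  by rewrite oner_eq0.
have := amul_self (g x); rewrite -gM amul_self -/e gh linearB.
rewrite [h (_ *: x)]linearZ [h (_ *: e)]linearZ -gh g1 /=.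
set a := inner x e; set a' := inner (g x) e.
set b := inner x x; set b' := inner (g x) (g x) => quad.
have quad' : (2 * (a - a')) *: g x = (b - b') *: e.
  rewrite mulrBr !scalerBl (canRL (subrK _) quad).
  by rewrite addrAC [_ - _ - _]addrAC subrr add0r addrC.
have aa' : a' = a.
  apply/eqP; rewrite eq_sym -subr_eq0; apply/negP => /negP d0; apply: x_nonreal.
  have d2 : 2 * (a - a') != 0 by rewrite mulf_neq0 // pnatr_eq0.
  exists ((2 * (a - a'))^-1 * (b - b')); apply: (bij_inj gb).
  by rewrite gh linearZ /= -gh g1 -scalerA -quad' scalerA mulVf // scale1r.
split=> //; move/eqP: quad'; rewrite aa' subrr mulr0 scale0r eq_sym.
by rewrite scaler_eq0 (negPf e0) orbF subr_eq0 => /eqP.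
Qed.

End Transitivity.

(** * The root manifold as a sphere *)

Theorem corollary2p4 (R : realType) (K : division_kind) (P : {poly R})
    (x0 : division_algebra R K)
    (x0_nonreal : ~ areal x0) (x0_root : aeval P x0 = 0) :
  manifold_dim (root_manifold x0) (\dim {: division_algebra R K} - 2)%N.
Proof.
set e := aone (division_algebra R K).
pose r := inner x0 e; pose c := inner x0 x0 - r ^+ 2.
have c_gt0 : 0 < c.
  (* The imaginary part of [x0]: its squared norm is [c], and it is nonzero as [x0] is not real. *)
  pose q := - r *: e + x0.
  have q0 : q != 0.
    apply/eqP => q0; apply: x0_nonreal; exists r.
    by apply/eqP; rewrite -subr_eq0 -scaleNr addrC -/q q0.
  suff <- : inner q q = c by exact: inner_gt0.
  rewrite /q inner_linear !(innerC _ (_ *: _ + _)) !inner_linear inner1.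
  by rewrite (innerC e) -/r /c; ring.
suff -> : root_manifold x0 = [set x | inner x e = r /\ inner x x = r ^+ 2 + c].
  apply: sphere_manifold => //; [exact: innerC | exact: inner_linear
    | exact: inner_gt0 | exact: inner1].
(* [r ^+ 2 + c] is [inner x0 x0]; invariance gives one inclusion, transitivity the other. *)
rewrite [_ + c]addrC subrK; apply/seteqP; split=> [_ [g gA <-]|x [xr xn]].
  exact: inner_Aut.
have [g [gA _] gx] := same_orbitP (esym xr) (esym xn).
by exists g.
Qed.
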